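(* Let $\epsilon>0$ be a sufficiently small constant. For all sufficiently large $X$ and all $Y$ with $1/X\le Y\le1/2$, $$\int_{-Y}^{Y}|S_2(\alpha)-U_2(\alpha)|^2\,d\alpha\ll_\epsilon\frac{\log^2X}{YX}+Y^2X+Y^2J^*\Bigl(X,\frac1{2Y}\Bigr),$$ where the implied constant depends only on $\epsilon$.
   Context: Notation: $e(u)=\exp(2\pi iu)$, $$S_2(\alpha)=\sum_{\epsilon X\le p^2\le X}\log p\;e(p^2\alpha)\ (p\text{ prime}),\qquad U_2(\alpha)=\sum_{\epsilon X\le n^2\le X}e(\alpha n^2)\ (n\text{ positive integer}),$$ $\theta(x)=\sum_{p\le x}\log p$ (sum over primes), and $$J^*(X,h)=\int_{\epsilon X}^{X}\Bigl(\theta(\sqrt{x+h})-\theta(\sqrt x)-(\sqrt{x+h}-\sqrt x)\Bigr)^2dx.$$ *)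

(* Defs.v *)
From mathcomp Require Import all_boot all_order all_algebra.
From mathcomp Require Import all_classical all_reals all_analysis.
From mathcomp Require Export complex.
Import Order.TTheory GRing.Theory Num.Theory.
Import numFieldNormedType.Exports.

Set Implicit Arguments.
Unset Strict Implicit.
Unset Printing Implicit Defensive.

Local Open Scope classical_set_scope.
Local Open Scope ring_scope.

(* e(u) = exp(2 pi i u) *)
Definition expi2pi (R : realType) (u : R) : R[i] :=
  (cos (2 * pi * u) +i* sin (2 * pi * u))%C.

(* In S2 and U2 the bound [n <= truncn X] only makes the range finite:
   a positive integer n with n ^ 2 <= X satisfies n <= n ^ 2 <= X. *)
Definition S2 (R : realType) (eps X alpha : R) : R[i] :=
  \sum_(0 <= p < (Num.truncn X).+1 |
      prime p && (eps * X <= p%:R ^+ 2 <= X))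
    (ln (p%:R : R))%:C%C * expi2pi (p%:R ^+ 2 * alpha).

Definition U2 (R : realType) (eps X alpha : R) : R[i] :=
  \sum_(0 <= n < (Num.truncn X).+1 |
      (0 < n)%N && (eps * X <= n%:R ^+ 2 <= X))
    expi2pi (alpha * n%:R ^+ 2).

(* [truncn x] is the integer part of x for 0 <= x, and 0 for x < 0. *)
Definition theta (R : realType) (x : R) : R :=
  \sum_(0 <= p < (Num.truncn x).+1 | prime p) ln (p%:R : R).

Definition Jstar (R : realType) (eps X h : R) : R :=
  Rintegral (@lebesgue_measure R) `[eps * X, X]
    (fun x : R => (theta (Num.sqrt (x + h)) - theta (Num.sqrt x)
                   - (Num.sqrt (x + h) - Num.sqrt x)) ^+ 2).

(* Main.v *)
(* A discrete form of Gallagher's lemma.  Put H = 1/(2Y), let N be the integer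
   nearest to H, and let c be the coefficients of S_2 - U_2 at the squares.  The
   product of S_2 - U_2 with the Dirichlet kernel D of length N has Fourier
   coefficients b(m) = sum of c(n) over n^2 <= m < n^2 + N.  Since |D| >= N/9 on
   [-Y, Y], Parseval on a full period bounds the integral by (81/N^2) sum b(m)^2.
   With m = k + N, b(m) sums c over squares in (k, k + N].  If this window lies
   inside [eps X, X], then on a subinterval of [k, k+1) of length at least 1/2 it
   contains the same squares as (x, x + H], so that b(m) differs from the
   quantity squared in J^* by less than 1.  There are O(H) windows meeting the ends of
   [eps X, X]; each contributes at most
   log^2 X (1 + N / (2 sqrt (eps X)))^2 by counting squares. *)
Require Import Defs.
From mathcomp Require Import all_boot all_order all_algebra.
From mathcomp Require Import all_classical all_reals all_analysis.
From mathcomp Require Import measurable_realfun.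
From mathcomp Require Import ring lra zify.
Import Order.TTheory GRing.Theory Num.Theory.
Import numFieldNormedType.Exports.
Local Open Scope classical_set_scope.
Local Open Scope ring_scope.

(** * Trigonometric sums over a full period and a discrete Gallagher inequality *)

Section TrigonometricSums.
Context {R : realType}.
Implicit Types (a b u x : R) (z : R[i]).
Local Notation mu := (@lebesgue_measure R).

Lemma ler_Rintegral_subset (A B : set R) (f : R -> R) :
  measurable A -> measurable B -> mu.-integrable B (EFin \o f) ->
  (forall x, B x -> 0 <= f x) -> A `<=` B ->
  \int[mu]_(x in A) f x <= \int[mu]_(x in B) f x.
Proof.
move=> mA mB fi f0 AB; rewrite /Rintegral fine_le//.
- by apply: integral_fune_fin_num => //; exact: integrableS fi.
- exact: integral_fune_fin_num.
- apply: ge0_subset_integral => //; exact: measurable_int fi.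
Qed.

Lemma sum_Rintegral_unit (A B : nat) (f : R -> R) : (A <= B)%N ->
  mu.-integrable `[A%:R, B%:R[ (EFin \o f) ->
  \sum_(A <= k < B) \int[mu]_(x in `[k%:R, k.+1%:R[) f x =
  \int[mu]_(x in `[A%:R, B%:R[) f x.
Proof.
elim: B => [|B IH].
  by rewrite leqn0 => /eqP-> _; rewrite big_geq// set_itv_ge ?Rintegral_set0//
    -leNgt bnd_simp.
rewrite leq_eqVlt => /predU1P[-> _|].
  by rewrite big_geq// set_itv_ge ?Rintegral_set0// -leNgt bnd_simp.
rewrite ltnS => AB fi; rewrite big_nat_recr//=.
have E : `[A%:R, B.+1%:R[%classic = `[A%:R, B%:R[ `|` `[B%:R, B.+1%:R[ :> set R.
  by rewrite -itv_bndbnd_setU // bnd_simp ler_nat.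
rewrite E in fi *.
rewrite Rintegral_setU // ?IH //.
  by apply: integrableS fi => //; exact: measurableU.
apply/disj_setPRL => x /=; rewrite !in_itv/=.
by move=> /andP[Bx _] /andP[_]; rewrite ltNge Bx.
Qed.

Lemma sqr_sin_le x : sin x ^+ 2 <= x ^+ 2.
Proof.
wlog x0 : x / 0 <= x.
  move=> H; have [|x0] := leP 0 x; first exact: H.
  by rewrite -sqrrN -sinN -[leRHS]sqrrN; apply: H; lra.
have [c _] := @MVT_segment R (fun y => sin y) (fun y => cos y) 0 x x0
  (fun y _ => is_derive_sin y) (continuous_subspaceT (@continuous_sin R)).
rewrite sin0 !subr0 => ->; rewrite exprMn ler_piMl ?sqr_ge0//.
Qed.

Lemma cos_ge_quadratic u : 1 - u ^+ 2 / 2 <= cos u.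
Proof.
have -> : u = (u / 2) *+ 2 by rewrite mulr2n; field.
rewrite cos_mulr2n cos2sin2 mulr2n.
have := sqr_sin_le (u / 2); lra.
Qed.

Lemma integrable_continuous a b (f : R -> R) : continuous f ->
  mu.-integrable `[a, b] (EFin \o f).
Proof.
move=> cf; apply: continuous_compact_integrable; first exact: segment_compact.
exact: continuous_subspaceT.
Qed.

(** The antiderivative sin(2 pi k x)/(2 pi k) takes the values ± sin(pi k)/(2 pi k) at the
    endpoints. Integrality of k enters through its sine so that differences of two naturals, of
    either sign, are covered at once. *)
Lemma integral_cos_multiple (k : R) : k != 0 -> sin (pi * k) = 0 ->
  \int[mu]_(x in `[- (1/2), 1/2]) cos (2 * pi * k * x) = 0.
Proof.
move=> k0 sk.
pose F (x : R) := (2 * pi * k)^-1 * sin (2 * pi * k * x).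
have p0 : 2 * pi * k != 0 :> R.
  by rewrite !mulf_eq0 (negbTE k0) pnatr_eq0 orbF /= gt_eqF // pi_gt0.
have dF (x : R) : is_derive x 1 F (cos (2 * pi * k * x)).
  rewrite /F.
  have d1 : is_derive x 1 (fun y : R => 2 * pi * k * y) (2 * pi * k).
    have := is_deriveZ (2 * pi * k) (is_derive_id x (1 : R)).
    by rewrite /GRing.scale /= mulr1.
  have d2 := is_derive1_comp (is_derive_sin (2 * pi * k * x)) d1.
  have := is_deriveZ (2 * pi * k)^-1 d2.
  move=> d3; refine (is_derive_eq d3 _).
  by rewrite /GRing.scale/= mulrCA mulVf ?mulr1.
have cc : continuous (fun x : R => cos (2 * pi * k * x)).
  move=> x; apply: continuous_comp; last exact: continuous_cos.
  exact: mulrl_continuous.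
have cF : continuous F.
  by move=> x; apply: differentiable_continuous; apply/derivable1_diffP; have [] := dF x.
rewrite /Rintegral (@continuous_FTC2 _ _ F) //; first last.
- by move=> x _; rewrite derive1E; exact: derive_val.
- split; first by move=> x _; have [] := dF x.
  + by apply: cvg_at_right_filter; exact: cF.
  + by apply: cvg_at_left_filter; exact: cF.
- exact: continuous_subspaceT.
- lra.
rewrite /F.
have -> : 2 * pi * k * (1 / 2) = pi * k by field.
have -> : 2 * pi * k * - (1 / 2) = - (pi * k) by field.
by rewrite sinN sk oppr0 mulr0 subee.
Qed.

Lemma sin_pi_nat (n : nat) : sin (pi * n%:R) = 0 :> R.
Proof.
elim: n => [|n IH]; first by rewrite mulr0 sin0.
by rewrite -addn1 natrD mulrDr mulr1 sinDpi IH oppr0.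
Qed.

Lemma sqr_normc z : Normc.normc z ^+ 2 = complex.Re z ^+ 2 + complex.Im z ^+ 2.
Proof. by case: z => a b /=; rewrite sqr_sqrtr// addr_ge0 ?sqr_ge0. Qed.

Lemma ler_Re_normc z : complex.Re z <= Normc.normc z.
Proof.
case: z => a b /=; apply: (le_trans (ler_norm a)).
by rewrite -sqrtr_sqr ler_sqrt ?addr_ge0 ?sqr_ge0// lerDl sqr_ge0.
Qed.

Lemma expi2piD u v : expi2pi (u + v) = expi2pi u * expi2pi v :> R[i].
Proof.
rewrite /expi2pi mulrDr cosD sinD; apply/eqP.
by rewrite eq_complex /= (addrC (_ * cos _)) [_ * sin _ + _]addrC !eqxx.
Qed.

Lemma normc_expi2pi u : Normc.normc (expi2pi u) = 1 :> R.
Proof. by rewrite /expi2pi /= cos2Dsin2 sqrtr1. Qed.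

Lemma Re_trigsum {I : Type} (r : seq I) (c t : I -> R) :
  complex.Re (\sum_(i <- r) (c i)%:C%C * expi2pi (t i)) =
  \sum_(i <- r) c i * cos (2 * pi * t i).
Proof.
elim: r => [|i r IH]; rewrite ?big_nil// !big_cons -IH.
by case: (\sum_(_ <- _) _) => p q /=; rewrite mul0r subr0.
Qed.

Lemma Im_trigsum {I : Type} (r : seq I) (c t : I -> R) :
  complex.Im (\sum_(i <- r) (c i)%:C%C * expi2pi (t i)) =
  \sum_(i <- r) c i * sin (2 * pi * t i).
Proof.
elim: r => [|i r IH]; rewrite ?big_nil// !big_cons -IH.
by case: (\sum_(_ <- _) _) => p q /=; rewrite mul0r addr0.
Qed.

(** The coefficients are real, so the cross terms combine by the formula for cos(a - b); all later
    integrals are then of real cosines. *)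
Lemma sqr_normc_trigsum {I : Type} (r : seq I) (c t : I -> R) :
  Normc.normc (\sum_(i <- r) (c i)%:C%C * expi2pi (t i)) ^+ 2 =
  \sum_(i <- r) \sum_(j <- r) c i * c j * cos (2 * pi * (t i - t j)).
Proof.
rewrite sqr_normc Re_trigsum Im_trigsum !expr2 !mulr_suml -big_split /=.
apply: eq_bigr => i _; rewrite !mulr_sumr -big_split /=; apply: eq_bigr => j _.
by rewrite mulrBr cosB; ring.
Qed.

Lemma continuous_bigsum {I : Type} (r : seq I) (f : I -> R -> R) :
  (forall i, continuous (f i)) -> continuous (fun x => \sum_(i <- r) f i x).
Proof.
move=> cf; elim: r => [|i r IH] x.
  under eq_fun do rewrite big_nil; exact: cvg_cst.
under eq_fun do rewrite big_cons; apply: cvgD; [exact: cf|exact: IH].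
Qed.

Lemma Rintegral_bigsum {I : Type} (r : seq I) (f : I -> R -> R) a b :
  (forall i, continuous (f i)) ->
  \int[mu]_(x in `[a, b]) (\sum_(i <- r) f i x) =
  \sum_(i <- r) \int[mu]_(x in `[a, b]) f i x.
Proof.
move=> cf; elim: r => [|i r IH].
  rewrite big_nil; under eq_Rintegral do rewrite big_nil.
  by rewrite Rintegral_cst// mul0r.
rewrite big_cons; under eq_Rintegral do rewrite big_cons.
rewrite RintegralD ?IH //; apply: integrable_continuous => //.
exact: continuous_bigsum.
Qed.

Lemma continuous_cosM c k : continuous (fun x : R => c * cos (2 * pi * (k * x))).
Proof.
have -> : (fun x => c * cos (2 * pi * (k * x))) = (fun x => c * cos (2 * pi * k * x)).
  by apply/funext => x; rewrite mulrA.
move=> x; apply: cvgM; first exact: cvg_cst.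
apply: continuous_comp; last exact: continuous_cos.
exact: mulrl_continuous.
Qed.

Lemma sqr_normc_trigsum_lin {I : Type} (r : seq I) (c t : I -> R) :
  (fun x => Normc.normc (\sum_(i <- r) (c i)%:C%C * expi2pi (t i * x)) ^+ 2) =
  (fun x => \sum_(i <- r) \sum_(j <- r) c i * c j * cos (2 * pi * ((t i - t j) * x))).
Proof.
apply/funext => x; rewrite sqr_normc_trigsum.
by under eq_bigr do under eq_bigr do rewrite -mulrBl.
Qed.

Lemma continuous_sqr_normc_trigsum {I : Type} (r : seq I) (c t : I -> R) :
  continuous (fun x => Normc.normc (\sum_(i <- r) (c i)%:C%C * expi2pi (t i * x)) ^+ 2).
Proof.
rewrite sqr_normc_trigsum_lin.
by apply: continuous_bigsum => i; apply: continuous_bigsum => j; exact: continuous_cosM.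
Qed.

(** Integrate the double cosine sum termwise: the diagonal gives b(m)^2 on an interval of length 1,
    and off the diagonal the frequency is a nonzero integer. *)
Lemma parseval (b : nat -> R) (L : nat) :
  \int[mu]_(x in `[- (1 / 2), 1 / 2])
     Normc.normc (\sum_(0 <= m < L) (b m)%:C%C * expi2pi (m%:R * x)) ^+ 2 =
  \sum_(0 <= m < L) b m ^+ 2.
Proof.
have /= -> := sqr_normc_trigsum_lin (index_iota 0 L) b (fun m => m%:R).
rewrite Rintegral_bigsum; last first.
  by move=> i; apply: continuous_bigsum => j; exact: continuous_cosM.
apply: eq_big_nat => m mL.
rewrite Rintegral_bigsum; last by move=> j; exact: continuous_cosM.
rewrite (bigD1_seq m) /= ?iota_uniq ?mem_index_iota// big1 ?addr0.
  under eq_Rintegral do rewrite subrr mul0r mulr0 cos0 mulr1.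
  rewrite Rintegral_cst//= lebesgue_measure_itv /= lte_fin.
  by rewrite ifT; last lra; rewrite -EFinB /=; lra.
move=> n nm.
rewrite RintegralZl//; last first.
  apply: integrable_continuous => x.
  by have := @continuous_cosM 1 (m%:R - n%:R) x; under eq_fun do rewrite mul1r.
under eq_Rintegral do rewrite mulrA.
rewrite integral_cos_multiple ?mulr0//; first by rewrite subr_eq0 eqr_nat eq_sym.
by rewrite mulrBr sinB !sin_pi_nat !mul0r mulr0 subr0.
Qed.

Lemma sum_sqr_shift (N : nat) x :
  \sum_(0 <= j < N) (j%:R - x) ^+ 2 =
  N%:R * ((N%:R - 1) * (2 * N%:R - 1) / 6 - x * (N%:R - 1) + x ^+ 2) :> R.
Proof.
elim: N => [|N IH]; first by rewrite big_nil mul0r.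
by rewrite big_nat_recr//= IH -natr1; field.
Qed.

(* Centring the kernel makes it a sum of cosines, to which cos u >= 1 - u^2/2 and
   pi < 4 apply. *)
Lemma dirichlet_kernel_ge (N : nat) x : x ^+ 2 * (N%:R ^+ 2 - 1) <= 1 / 3 ->
  N%:R / 9 <= Normc.normc (\sum_(0 <= j < N) expi2pi (j%:R * x)) :> R.
Proof.
move=> hx; pose s : R := (N%:R - 1) / 2.
have -> : Normc.normc (\sum_(0 <= j < N) expi2pi (j%:R * x)) =
    Normc.normc ((\sum_(0 <= j < N) expi2pi (j%:R * x)) * expi2pi (- s * x)) :> R.
  by rewrite Normc.normcM normc_expi2pi mulr1.
apply: le_trans (ler_Re_normc _).
rewrite mulr_suml.
have -> : \sum_(0 <= j < N) expi2pi (j%:R * x) * expi2pi (- s * x) =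
  \sum_(0 <= j < N) (1 : R)%:C%C * expi2pi ((j%:R - s) * x).
  by apply: eq_bigr => j _; rewrite -expi2piD mul1r -mulrDl.
rewrite Re_trigsum.
have : \sum_(0 <= j < N) (1 - 2 * pi ^+ 2 * x ^+ 2 * (j%:R - s) ^+ 2) <=
    \sum_(0 <= j < N) 1 * cos (2 * pi * ((j%:R - s) * x)).
  apply: ler_sum => j _; rewrite mul1r; apply: le_trans (cos_ge_quadratic _).
  by lra.
apply: le_trans.
rewrite sumrB -mulr_sumr sum_sqr_shift sumr_const_nat subn0.
(* This is the variance of the uniform distribution on 0, ..., N - 1, whose mean is s. *)
have -> : (N%:R - 1) * (2 * N%:R - 1) / 6 - s * (N%:R - 1) + s ^+ 2 =
    (N%:R ^+ 2 - 1) / 12 :> R.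
  by rewrite /s; field.
have p4 : pi ^+ 2 <= 16 :> R by have := pihalf_lt2 R; have := pi_gt0 R; nra.
have N0 : 0 <= N%:R :> R by [].
(* This leaves N (1 - (16/3)/6) = N/9. *)
have h : pi ^+ 2 * (x ^+ 2 * (N%:R ^+ 2 - 1)) <= 16 / 3.
  case: (leP 0 (x ^+ 2 * (N%:R ^+ 2 - 1))) => [h0|/ltW h0].
    have := sqr_ge0 (pi : R); nra.
  have := sqr_ge0 (pi : R); nra.
have -> : 2 * pi ^+ 2 * x ^+ 2 * (N%:R * ((N%:R ^+ 2 - 1) / 12)) =
  N%:R * (pi ^+ 2 * (x ^+ 2 * (N%:R ^+ 2 - 1)) / 6) by field.
nra.
Qed.

(** In the product, the frequency m arises from i exactly once, with j = m - nu(i), when nu(i) <= m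
    < nu(i) + N. The bound by L ensures that no frequency of the product is cut off. *)
Lemma trigsum_mul_dirichlet (I : eqType) (r : seq I) (c : I -> R) (nu : I -> nat)
    (N L : nat) x : (forall i, i \in r -> (nu i + N <= L)%N) ->
  \sum_(0 <= m < L) (\sum_(i <- r | (nu i <= m < nu i + N)%N) c i)%:C%C *
    expi2pi (m%:R * x) =
  (\sum_(i <- r) (c i)%:C%C * expi2pi ((nu i)%:R * x)) *
    \sum_(0 <= j < N) expi2pi (j%:R * x).
Proof.
move=> nuL; rewrite mulr_suml.
under eq_bigr do rewrite rmorph_sum mulr_suml big_mkcond.
rewrite exchange_big big_seq [RHS]big_seq; apply: eq_bigr => i ir.
rewrite -big_mkcond /= mulr_sumr.
have := nuL _ ir => iL.
rewrite (big_cat_nat (n := nu i)) //=; last by apply: leq_trans iL; exact: leq_addr.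
rewrite big_nat_cond big1 ?add0r; last by move=> m; lia.
rewrite (big_cat_nat (n := nu i + N)) //=; last exact: leq_addr.
rewrite [X in _ + X]big_nat_cond [X in _ + X]big1 ?addr0; last by move=> m; lia.
rewrite -[in LHS](add0n (nu i)) big_addn addnC addnK.
rewrite big_nat_cond [RHS]big_nat_cond; apply: eq_big => [m|m _]; first lia.
by rewrite natrD mulrDl expi2piD; ring.
Qed.

(** The condition on Y^2 (N^2 - 1) is the hypothesis of the kernel bound at the endpoint x = Y.
    Keeping the -1 makes it hold trivially for N = 1, which is the case Y = 1/2. *)
Lemma discrete_gallagher (I : eqType) (r : seq I) (c : I -> R) (nu : I -> nat)
    (N L : nat) (Y : R) :
  (0 < N)%N -> 0 <= Y -> Y <= 1 / 2 -> Y ^+ 2 * (N%:R ^+ 2 - 1) <= 1 / 3 ->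
  (forall i, i \in r -> (nu i + N <= L)%N) ->
  \int[mu]_(x in `[- Y, Y])
     Normc.normc (\sum_(i <- r) (c i)%:C%C * expi2pi ((nu i)%:R * x)) ^+ 2 <=
  81 / N%:R ^+ 2 *
    \sum_(0 <= m < L) (\sum_(i <- r | (nu i <= m < nu i + N)%N) c i) ^+ 2.
Proof.
move=> N0 Y0 Y12 YN nuL; 
pose b (m : nat) := \sum_(i <- r | (nu i <= m < nu i + N)%N) c i.
have N1 : 1 <= N%:R :> R by rewrite ler1n.
pose P x := Normc.normc (\sum_(i <- r) (c i)%:C%C * expi2pi ((nu i)%:R * x)) ^+ 2.
pose Q x := Normc.normc (\sum_(0 <= m < L) (b m)%:C%C * expi2pi (m%:R * x)) ^+ 2.
have cP : continuous P by exact: continuous_sqr_normc_trigsum.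
have cQ : continuous Q by exact: (continuous_sqr_normc_trigsum _ _ (fun m => m%:R)).
have iQ u v : mu.-integrable `[u, v] (EFin \o Q) by exact: integrable_continuous.
rewrite -(parseval b L).
apply: (@le_trans _ _ (81 / N%:R ^+ 2 * \int[mu]_(x in `[- Y, Y]) Q x)).
  rewrite -RintegralZl//; apply: le_Rintegral => //.
  - exact: integrable_continuous.
  - apply: integrable_continuous => x; apply: cvgM; first exact: cvg_cst.
    exact: cQ.
  move=> x; rewrite /= in_itv /= => /andP[xY Yx].
  have xN : x ^+ 2 * (N%:R ^+ 2 - 1) <= 1 / 3.
    apply: le_trans YN; apply: ler_wpM2r; first nra.
    nra.
  have D := dirichlet_kernel_ge _ _ xN.
  rewrite /Q /b trigsum_mul_dirichlet // Normc.normcM exprMn -/(P x).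
  set d := Normc.normc _ in D *.
  have P0 : 0 <= P x by exact: sqr_ge0.
  have : 1 <= 81 / N%:R ^+ 2 * d ^+ 2.
    rewrite mulrAC ler_pdivlMr ?mul1r; last by rewrite exprn_gt0 ?ltr0n.
    nra.
  nra.
apply: ler_wpM2l; first by rewrite divr_ge0// sqr_ge0.
apply: ler_Rintegral_subset => //; first by move=> x _; exact: sqr_ge0.
by move=> x; rewrite /= !in_itv /=; lra.
Qed.

End TrigonometricSums.

(** * Weighted sums over squares in short windows and their comparison with [Jstar] *)

Section SquareWindows.
Context {R : realType}.
Implicit Types (a b x y eps X : R).
Local Notation mu := (@lebesgue_measure R).

Lemma ln_nat_ge0 (n : nat) : 0 <= ln n%:R :> R.
Proof. by case: n => [|n]; [rewrite ln0|rewrite ln_ge0// ler1n]. Qed.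

Lemma theta_nondecreasing : {homo @theta R : x y / x <= y}.
Proof.
move=> x y xy; rewrite /theta [leRHS](big_cat_nat (n := (Num.truncn x).+1)) //=.
  by rewrite lerDl sumr_ge0// => i _; exact: ln_nat_ge0.
by rewrite ltnS le_truncn.
Qed.

Lemma theta_ge0 x : 0 <= theta x.
Proof. by apply: sumr_ge0 => i _; exact: ln_nat_ge0. Qed.

Definition theta_error (h x : R) : R :=
  theta (Num.sqrt (x + h)) - theta (Num.sqrt x) - (Num.sqrt (x + h) - Num.sqrt x).

Lemma measurable_theta_error h (D : set R) : measurable D ->
  measurable_fun D (theta_error h).
Proof.
move=> mD; have s x y : x <= y -> Num.sqrt (x + h) <= Num.sqrt (y + h).
  by move=> xy; rewrite ler_wsqrtr// lerD2r.
apply: measurable_funB; apply: measurable_funB; apply: nondecreasing_measurable => //.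
- by move=> x y xy; apply/theta_nondecreasing/s.
- by move=> x y xy; apply/theta_nondecreasing; rewrite ler_wsqrtr.
- by move=> x y; exact: ler_wsqrtr.
Qed.

Lemma integrable_sqr_theta_error h a b : 0 <= h ->
  mu.-integrable `[a, b] (EFin \o (fun x => theta_error h x ^+ 2)).
Proof.
move=> h0; apply: measurable_bounded_integrable => //.
- by apply: compact_finite_measure; exact: segment_compact.
- by apply: measurable_funX; exact: measurable_theta_error.
(* By monotonicity both the theta increment and the square root increment lie between 0 and their
   values at the right end. *)
pose K := theta (Num.sqrt (b + h)) + Num.sqrt (b + h).
exists (K ^+ 2); split; first exact: num_real.
move=> t Kt x; rewrite /= in_itv /= => /andP[_ xb].
rewrite ger0_norm ?sqr_ge0//; apply: le_trans (ltW Kt).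
have h1 : Num.sqrt x <= Num.sqrt (x + h) by rewrite ler_wsqrtr// lerDl.
have h2 : Num.sqrt (x + h) <= Num.sqrt (b + h) by rewrite ler_wsqrtr// lerD2r.
have h3 := theta_nondecreasing _ _ h1.
have h4 := theta_nondecreasing _ _ h2.
have h5 := theta_ge0 (Num.sqrt x).
have h6 := sqrtr_ge0 x.
by rewrite /theta_error /K; nra.
Qed.

Definition square_window eps X : seq nat :=
  [seq n <- index_iota 0 (Num.truncn X).+1 | (0 < n)%N && (eps * X <= n%:R ^+ 2 <= X)].

(** The coefficient c(n) of e(n^2 alpha) in S_2 - U_2. *)
Definition prime_weight (n : nat) : R := (if prime n then ln n%:R else 0) - 1.

Lemma S2_sub_U2 eps X x : S2 eps X x - U2 eps X x =
  \sum_(n <- square_window eps X) (prime_weight n)%:C%C * expi2pi ((n ^ 2)%N%:R * x).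
Proof.
rewrite /S2 /U2 big_filter big_mkcond [X in _ - X]big_mkcond [RHS]big_mkcond -sumrB.
apply: eq_bigr => n _; rewrite /prime_weight natrX [x * _]mulrC.
case: n => [|n] /=; first by rewrite subrr.
case: ifP => [/andP[-> ->]|] /=; first by rewrite rmorphB mulrBl mul1r.
case: (prime n.+1) => /= [->|_]; first by rewrite subrr.
by case: ifP => _; rewrite ?subrr// !sub0r rmorphN rmorph1 mulN1r.
Qed.

(** The Fourier coefficient b(m), collecting the squares in (m - N, m]. *)
Definition window_sum eps X (N m : nat) : R :=
  \sum_(n <- square_window eps X | (n ^ 2 <= m < n ^ 2 + N)%N) prime_weight n.

(** All entries lie among the floor(t) + 1 consecutive integers that start at the minimum of s. *)
Lemma size_le_diameter (s : seq nat) (t : R) : uniq s -> 0 <= t ->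
  {in s &, forall n1 n2, n2%:R - n1%:R <= t} -> (size s)%:R <= t + 1.
Proof.
move=> us t0 st; case: (s =P [::]) => [->|/eqP s0]; first by rewrite addr_ge0.
have exs : exists n, n \in s.
  by case: s s0 {us st} => // n s _; exists n; rewrite mem_head.
have [n0 n0s n0min] := ex_minnP exs.
have sub : {subset s <= iota n0 (Num.truncn t).+1}.
  move=> n ns; rewrite mem_iota n0min //= addnS ltnS -leq_subLR.
  by rewrite truncn_ge_nat// natrB ?n0min// st.
have := uniq_leq_size us sub; rewrite size_iota => h.
apply: (@le_trans _ _ (Num.truncn t).+1%:R); first by rewrite ler_nat.
by rewrite -natr1 lerD2r truncn_le.
Qed.

(** Since 1 <= n <= n^2 <= X, the logarithm lies in [0, ln X]; the assumption 1 <= ln X absorbs the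
    -1. *)
Lemma normr_prime_weight_le eps X n : 1 <= ln X -> n \in square_window eps X ->
  `|prime_weight n| <= ln X.
Proof.
move=> lX; rewrite mem_filter => /andP[/andP[n0 /andP[_ nX]] _].
have n1 : 1 <= n%:R :> R by rewrite ler1n.
have nX' : n%:R <= X by nra.
have h : ln n%:R <= ln X by rewrite ler_ln// posrE; lra.
have h0 : 0 <= ln n%:R :> R by rewrite ln_ge0.
rewrite /prime_weight ler_norml; case: ifP => _; lra.
Qed.

(** If n1 < n2 both contribute, then (n2 - n1)(n2 + n1) <= N while n1 + n2 >= 2 sqrt(eps X). This
    bounds the spread of the contributing n, hence their number. *)
Lemma window_sum_le eps X (N m : nat) : 0 < eps -> 0 < X -> 1 <= ln X ->
  `|window_sum eps X N m| <= ln X * (N%:R / (2 * Num.sqrt (eps * X)) + 1).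
Proof.
move=> e0 X0 lX; rewrite /window_sum -big_filter; set s := [seq _ <- _ | _].
have sw n : n \in s -> n \in square_window eps X by rewrite mem_filter => /andP[].
set w := Num.sqrt _.
have w0 : 0 < w by rewrite sqrtr_gt0 mulr_gt0.
have w2 : w ^+ 2 = eps * X by rewrite sqr_sqrtr// ltW// mulr_gt0.
apply: le_trans (ler_norm_sum _ _ _) _.
apply: (@le_trans _ _ (\sum_(n <- s) ln X)).
  rewrite big_seq [leRHS]big_seq; apply: ler_sum => n ns.
  by apply: (@normr_prime_weight_le eps) => //; exact: sw.
rewrite big_const_seq iter_addr_0 count_predT -[ln X *+ _]mulr_natr ler_pM2l; last lra.
apply: size_le_diameter; first by rewrite !filter_uniq// iota_uniq.
  by rewrite divr_ge0// mulr_ge0// ltW.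
have ws n : n \in s -> w <= n%:R.
  move=> /sw; rewrite mem_filter => /andP[/and3P[_ wn _] _].
  by rewrite -[leRHS]ger0_norm// -sqrtr_sqr ler_wsqrtr.
move=> n1 n2 n1s n2s; have := ws _ n1s; have := ws _ n2s.
move: n1s n2s; rewrite !mem_filter => /andP[/andP[_ n1N] _] /andP[/andP[n2m _] _].
rewrite ler_pdivlMr; last lra.
have : (n2 ^ 2 <= n1 ^ 2 + N)%N by apply: leq_trans n2m (ltnW n1N).
rewrite -(ler_nat R) natrD !natrX; have : 0 <= N%:R :> R by [].
by have [|] := leP (n1%:R : R) n2%:R; nra.
Qed.

(** Puts sums with different cutoffs y on one common range, so that they can be subtracted
    termwise. *)
Lemma sum_le_sqrt X y (P : pred nat) (F : nat -> R) : 1 <= X -> 0 <= y -> y <= X ->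
  \sum_(0 <= n < (Num.truncn (Num.sqrt y)).+1 | P n) F n =
  \sum_(0 <= n < (Num.truncn X).+1 | P n && (n%:R ^+ 2 <= y)) F n.
Proof.
move=> X1 y0 yX.
have sX : Num.sqrt y <= X.
  by rewrite -[X]ger0_norm ?(le_trans _ X1)// -sqrtr_sqr ler_wsqrtr//; nra.
rewrite (big_nat_widen _ _ (Num.truncn X).+1); last by rewrite ltnS le_truncn.
apply: eq_bigl => n; congr (_ && _).
rewrite ltnS truncn_ge_nat ?sqrtr_ge0//.
by rewrite -[in RHS](sqr_sqrtr y0) ler_sqr ?nnegrE ?sqrtr_ge0.
Qed.

(** Here k and k + N are the integer parts of x and x + h, so (k, k + N] and (x, x + h] contain the
    same squares. The weight -1 counts integers, whence the integer parts of the square roots. *)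
Lemma window_sum_theta eps X (N k : nat) (h x : R) : 0 < eps -> 1 <= X -> 0 <= h ->
  eps * X <= k%:R -> x + h <= X -> k%:R <= x -> x < k.+1%:R ->
  (k + N)%:R <= x + h -> x + h < (k + N).+1%:R ->
  window_sum eps X N (k + N) =
    theta (Num.sqrt (x + h)) - theta (Num.sqrt x) -
    ((Num.truncn (Num.sqrt (x + h)))%:R - (Num.truncn (Num.sqrt x))%:R).
Proof.
move=> e0 X1 h0 ek xX kx xk Nx xN.
have k0 : 0 <= k%:R :> R by [].
have cnt y : 0 <= y -> y <= X -> (Num.truncn (Num.sqrt y))%:R =
    \sum_(0 <= n < (Num.truncn X).+1 | (0 < n)%N && (n%:R ^+ 2 <= y)) 1 :> R.
  move=> y0 yX; rewrite -sum_le_sqrt// big_mkcond big_nat_recl//= add0r.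
  by rewrite sumr_const_nat subn0.
have le_k n : (n%:R ^+ 2 <= x) = (n ^ 2 <= k)%N.
  apply/idP/idP => [H|]; last by rewrite -(ler_nat R) natrX => /le_trans; exact.
  by rewrite -ltnS -(ltr_nat R) natrX (le_lt_trans H).
have le_kN n : (n%:R ^+ 2 <= x + h) = (n ^ 2 <= k + N)%N.
  apply/idP/idP => [H|]; last by rewrite -(ler_nat R) natrX => /le_trans; exact.
  by rewrite -ltnS -(ltr_nat R) natrX (le_lt_trans H).
rewrite /theta !(sum_le_sqrt X) ?cnt //; try lra.
rewrite /window_sum big_filter_cond big_mkcond.
rewrite ![\sum_(_ <= _ < _ | _ && _) _]big_mkcond -!sumrB.
apply: eq_bigr => n _; rewrite le_k le_kN /prime_weight.
(* The restriction eps X <= n^2 <= X is automatic, as eps X <= k < n^2 <= k + N <= x + h <= X. *)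
have -> : [&& (0 < n)%N && (eps * X <= n%:R ^+ 2 <= X), (n ^ 2 <= k + N)%N
      & (k + N < n ^ 2 + N)%N] = [&& (0 < n)%N, (k < n ^ 2)%N & (n ^ 2 <= k + N)%N].
  rewrite ltn_add2r -andbA; congr (_ && _).
  case: (ltnP k (n ^ 2)) => nk; last by rewrite !andbF.
  case: leqP => nN; last by rewrite !andbF.
  rewrite !andbT -natrX; apply/andP; split.
    by apply: (le_trans ek); rewrite ler_nat ltnW.
  by apply: le_trans xX; apply: le_trans Nx; rewrite ler_nat.
case: n => [|n]; first by rewrite !subrr.
have [nk|nk] := leqP (n.+1 ^ 2) k.
  by rewrite (leq_trans nk (leq_addr _ _)) !andbT; case: ifP; rewrite !subrr.
rewrite !andbF !subr0 !andTb; case: leqP => _; rewrite ?andbT ?andbF ?subr0//.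
Qed.

Lemma sqr_window_sum_le eps X (N k : nat) (h : R) :
  0 < eps -> 1 <= X -> 0 <= h -> eps * X <= k%:R -> k.+1%:R + h <= X ->
  `|N%:R - h| <= 1 / 2 ->
  window_sum eps X N (k + N) ^+ 2 <=
    4 * \int[mu]_(x in `[k%:R, k.+1%:R[) theta_error h x ^+ 2 + 4.
Proof.
move=> e0 X1 h0 ek kX; rewrite ler_norml => /andP[Nh1 Nh2].
set b2 := _ ^+ 2; pose g x := theta_error h x ^+ 2.
(* [p, q) is the set of x in [k, k + 1) for which x + h has integer part k + N. Its length is 1 - |N
   - h|. *)
have [p [q [kp qk pq Np Nq]]] : exists p q : R,
    [/\ k%:R <= p, q <= k.+1%:R, 1 / 2 <= q - p, k%:R + N%:R - h <= p
      & q <= k%:R + N%:R - h + 1].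
  rewrite -natr1; have [hN|hN] := leP h N%:R.
    by exists (k%:R + N%:R - h), (k%:R + 1); split; lra.
  by exists k%:R, (k%:R + N%:R - h + 1); split; lra.
have ig : mu.-integrable `[k%:R, k.+1%:R[ (EFin \o g).
  apply: (@integrableS _ _ _ mu `[k%:R, k.+1%:R]) => //.
    by move=> x; rewrite /= !in_itv /= => /andP[-> /ltW].
  exact: integrable_sqr_theta_error.
have pqk : `[p, q[ `<=` `[k%:R, k.+1%:R[.
  by move=> x; rewrite /= !in_itv /= => /andP[px xq]; lra.
have ig' : mu.-integrable `[p, q[ (EFin \o g) by exact: integrableS ig.
have icst (c : R) : mu.-integrable `[p, q[ (EFin \o cst c).
  apply: (@integrableS _ _ _ mu `[p, q]) => //.
    by move=> x; rewrite /= !in_itv /= => /andP[-> /ltW].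
  by apply: integrable_continuous => x; exact: cvg_cst.
(* Replacing integer parts of square roots by the roots costs a difference of two fractional parts,
   at most 1 in absolute value; then (u + d)^2 <= 2 u^2 + 2 d^2. *)
have b2g x : x \in `[p, q[ -> b2 - 2 <= 2 * g x.
  rewrite in_itv /= => /andP[px xq].
  rewrite /b2 (@window_sum_theta eps X N k h x) ?natrD //; try by rewrite -?natr1 ?natrD; lra.
  rewrite /g /theta_error.
  have := truncn_itv (sqrtr_ge0 (x + h)); have := truncn_itv (sqrtr_ge0 x).
  rewrite -(natr1 (Num.truncn (Num.sqrt x))) -(natr1 (Num.truncn (Num.sqrt (x + h)))).
  move=> /andP[t1 t2] /andP[t3 t4].
  set T := theta _ - _.
  set s1 := Num.sqrt _ in t3 t4 *; set s0 := Num.sqrt _ in t1 t2 *.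
  set n1 := _%:R in t3 t4 *; set n0 := _%:R in t1 t2 *.
  have := sqr_ge0 ((T - (s1 - s0)) - (s1 - s0 - (n1 - n0))).
  have : (s1 - s0 - (n1 - n0)) ^+ 2 <= 1 by nra.
  nra.
have : \int[mu]_(x in `[p, q[) (b2 - 2) <= \int[mu]_(x in `[p, q[) (2 * g x).
  apply: le_Rintegral => //; first exact: icst.
  have : mu.-integrable `[p, q[ (fun x => 2%:E * (EFin \o g) x)%E.
    by apply: integrableZl.
  by [].
rewrite RintegralZl// Rintegral_cst//= lebesgue_measure_itv/= lte_fin ifT; last lra.
rewrite -EFinB /= => H.
have Hs : \int[mu]_(x in `[p, q[) g x <= \int[mu]_(x in `[k%:R, k.+1%:R[) g x.
  by apply: ler_Rintegral_subset => // x _; exact: sqr_ge0.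
have g0 : 0 <= \int[mu]_(x in `[p, q[) g x by apply: Rintegral_ge0 => x _; exact: sqr_ge0.
change (b2 <= 4 * \int[mu]_(x in `[k%:R, k.+1%:R[) g x + 4).
move: (Rintegral _ _ _) (Rintegral _ _ _) H Hs g0 => J1 J2 H Hs g0.
clearbody b2; clear - pq H Hs g0.
(* Only when b2 - 2 is positive may the length q - p be replaced by its lower bound 1/2. *)
case: (leP b2 2) => hb; first lra.
have : (b2 - 2) * (1 / 2) <= (b2 - 2) * (q - p) by apply: ler_wpM2l => //; lra.
lra.
Qed.

(** Apply ln q < q to the fourth root q of X: ln X = 4 ln q < 4 q. *)
Lemma sqr_ln_le X : 1 <= X -> ln X ^+ 2 <= 16 * Num.sqrt X.
Proof.
move=> X1; set s := Num.sqrt X; set q := Num.sqrt s.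
have s0 : 0 < s by rewrite sqrtr_gt0; lra.
have q0 : 0 < q by rewrite sqrtr_gt0.
have q2 : q ^+ 2 = s by rewrite sqr_sqrtr ?ltW.
have s2 : s ^+ 2 = X by rewrite sqr_sqrtr; lra.
have E : ln X = ln q *+ 4 by rewrite -lnXn// -s2 -q2 -exprM.
have := ln_sublinear q0; have := ln_ge0 X1; rewrite E -q2; nra.
Qed.

Lemma sum_sqr_window_sum_le eps X (N : nat) (h : R) :
  0 < eps -> eps < 1 / 4 -> 8 <= X -> 1 <= ln X -> 1 <= h -> h <= X / 2 ->
  `|N%:R - h| <= 1 / 2 ->
  \sum_(0 <= m < (Num.truncn X).+1 + N) window_sum eps X N m ^+ 2 <=
    12 * h * ln X ^+ 2 * (h ^+ 2 / (eps * X) + 1) + 4 * X + 4 * Jstar eps X h.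
Proof.
move=> e0 e4 X8 lX h1 hX Nh; have := Nh; rewrite ler_norml => /andP[Nh1 Nh2].
have eX0 : 0 < eps * X by nra.
set M := (Num.truncn X).+1; set T := Num.truncn (eps * X).
set B := Num.truncn (X - h).
have /andP[M1 M2] : M%:R - 1 <= X < M%:R.
  by rewrite /M -natr1 addrK natr1 truncn_itv; lra.
have /andP[T1 T2] : T%:R <= eps * X < T%:R + 1 by rewrite natr1 truncn_itv// ltW.
have /andP[B1 B2] : B%:R <= X - h < B%:R + 1 by rewrite natr1 truncn_itv//; lra.
(* T + 1 <= X/4 + 1 and B > X/2 - 1: this is where eps < 1/4 and X >= 8 are used. *)
have TB : (T.+1 <= B)%N by rewrite -(ler_nat R) -natr1; nra.
have BM : (B <= M)%N by rewrite -(ler_nat R); lra.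
set b := window_sum eps X N.
pose w := Num.sqrt (eps * X).
have w2 : w ^+ 2 = eps * X by rewrite sqr_sqrtr// ltW.
have w0 : 0 < w by rewrite sqrtr_gt0.
(* Crude bound for one window: N <= 2h gives the factor (h/w + 1)^2 <= 2 ((h/w)^2 + 1). *)
pose E := ln X ^+ 2 * (2 * (h ^+ 2 / (eps * X) + 1)).
have bE m : b m ^+ 2 <= E.
  rewrite -[b m ^+ 2]ger0_norm ?sqr_ge0// normrX.
  have := @window_sum_le eps X N m e0 ltac:(lra) lX; rewrite -/b -/w => Hb.
  apply: (@le_trans _ _ ((ln X * (h / w + 1)) ^+ 2)).
    rewrite ler_sqr ?nnegrE//; last first.
      by apply: mulr_ge0; [lra|rewrite addr_ge0 ?divr_ge0 ?ltW//; lra].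
    apply: le_trans Hb _; apply: ler_wpM2l; first lra.
    rewrite lerD2r ler_pdivrMr; last lra.
    have -> : h / w * (2 * w) = 2 * h by field; lra.
    lra.
  rewrite exprMn /E; apply: ler_wpM2l; first exact: sqr_ge0.
  have -> : h ^+ 2 / (eps * X) = (h / w) ^+ 2 by rewrite expr_div_n w2.
  by have := sqr_ge0 (h / w - 1); lra.
rewrite (big_cat_nat (n := (T.+1 + N)%N)) //=; last by rewrite leq_add2r (leq_trans TB).
rewrite [X in _ + X <= _](big_cat_nat (n := (B + N)%N)) //=; last 2 first.
- by rewrite leq_add2r.
- by rewrite leq_add2r.
rewrite (big_cat_nat (n := T)) //=; last by rewrite addSnnS leq_addr.
(* These windows end below eps X and contain no admissible square. The blocks from T to T + 1 + N
   and from B + N to M + N hold the end windows; those in between lie inside [eps X, X]. *)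
have -> : \sum_(0 <= m < T) b m ^+ 2 = 0.
  rewrite big_nat big1// => m /andP[_ mT].
  rewrite /b /window_sum big_seq_cond big1 ?expr0n// => n /andP[].
  rewrite mem_filter => /andP[/andP[_ /andP[en _]] _] /andP[nm _].
  suff : m%:R < m%:R :> R by rewrite ltxx.
  apply: (@lt_le_trans _ _ T%:R); first by rewrite ltr_nat.
  by apply: (le_trans T1); apply: (le_trans en); rewrite -natrX ler_nat.
have e1 : \sum_(T <= m < T.+1 + N) b m ^+ 2 <= E * (N%:R + 1).
  apply: le_trans (ler_sum _ (fun m _ => bE m)) _.
  by rewrite sumr_const_nat -[E *+ _]mulr_natr addSnnS addKn -natr1.
have e2 : \sum_(B + N <= m < M + N) b m ^+ 2 <= E * (M%:R - B%:R).
  apply: le_trans (ler_sum _ (fun m _ => bE m)) _.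
  by rewrite sumr_const_nat -[E *+ _]mulr_natr subnDr natrB.
have e3 : \sum_(T.+1 + N <= m < B + N) b m ^+ 2 <= 4 * Jstar eps X h + 4 * X.
  rewrite big_addn addnK.
  apply: (@le_trans _ _ (\sum_(T.+1 <= k < B)
      (4 * \int[mu]_(x in `[k%:R, k.+1%:R[) theta_error h x ^+ 2 + 4))).
    rewrite big_nat [leRHS]big_nat; apply: ler_sum => k /andP[Tk kB].
    apply: sqr_window_sum_le => //; try lra.
    - move: Tk; rewrite -(ler_nat R) -natr1; lra.
    - move: kB; rewrite -(ler_nat R); lra.
  have iJ : mu.-integrable `[eps * X, X] (EFin \o (fun x => theta_error h x ^+ 2)).
    by apply: integrable_sqr_theta_error; lra.
  have sub : `[T.+1%:R, B%:R[ `<=` `[eps * X, X].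
    by move=> x; rewrite /= !in_itv /= -natr1 => /andP[]; lra.
  rewrite big_split /= -mulr_sumr sum_Rintegral_unit//; last first.
    exact: integrableS iJ.
  rewrite sumr_const_nat -[4 *+ _]mulr_natr; apply: lerD.
    rewrite ler_pM2l//; apply: ler_Rintegral_subset => // x _; exact: sqr_ge0.
  rewrite ler_pM2l// natrB//; have : 0 <= T.+1%:R :> R by []. lra.
have E0 : 0 <= E.
  rewrite /E; apply: mulr_ge0; first exact: sqr_ge0.
  by rewrite mulr_ge0// addr_ge0// divr_ge0 ?sqr_ge0// ltW.
(* The two end blocks have at most (h + 3/2) + (h + 2) windows, and h >= 1. *)
have : E * (N%:R + 1) + E * (M%:R - B%:R) <= E * (6 * h).
  by rewrite -mulrDr; apply: ler_wpM2l => //; lra.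
have -> : E * (6 * h) = 12 * h * ln X ^+ 2 * (h ^+ 2 / (eps * X) + 1) by rewrite /E; ring.
lra.
Qed.

End SquareWindows.

(** * Choice of constants and the final estimate *)

Theorem lemma3p12 (R : realType) :
  exists2 eps0 : R, 0 < eps0 &
    forall eps : R, 0 < eps -> eps < eps0 ->
      exists C X0 : R, 0 < C /\
        forall X : R, X0 <= X ->
        forall Y : R, 1 / X <= Y -> Y <= 1 / 2 ->
          Rintegral (@lebesgue_measure R) `[- Y, Y]
            (fun alpha : R =>
               (Normc.normc (S2 eps X alpha - U2 eps X alpha)) ^+ 2)
          <= C * (ln X ^+ 2 / (Y * X) + Y ^+ 2 * X
                  + Y ^+ 2 * Jstar eps X (1 / (2 * Y))).
Proof.
exists (1 / 4) => // eps e0 e4.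
(* 1296 = 81 * 16 comes from N Y >= 1/4; 100 = 6 * 16 + 4 is the final coefficient of Y^2 X, and
   2/eps + 100 also dominates the coefficient 3/(2 eps) + 6 of the first term. The threshold ensures
   ln X >= 1 and X >= 8. *)
exists (1296 * (2 / eps + 100)), (expR 1 + 8); split.
  by have : 0 < 2 / eps by [rewrite divr_gt0]; lra.
move=> X XX0 Y XY Y2.
have X8 : 8 <= X by have := expR_gt0 (1 : R); lra.
have lX : 1 <= ln X.
  rewrite -[1]expRK ler_ln ?posrE ?expR_gt0//; lra.
have Y0 : 0 < Y by apply: lt_le_trans XY; rewrite divr_gt0//; lra.
have YX : 1 <= Y * X by move: XY; rewrite ler_pdivrMr//; lra.
set h := 1 / (2 * Y).
have hY : h * Y = 1 / 2 by rewrite /h; field; lra.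
have h1 : 1 <= h by nra.
have hX : h <= X / 2 by nra.
pose N := Num.truncn (h + 1 / 2).
have /andP[N1 N2] : N%:R <= h + 1 / 2 < N%:R + 1 by rewrite natr1 truncn_itv; lra.
have N0 : (0 < N)%N by rewrite truncn_gt0; lra.
under eq_Rintegral do rewrite S2_sub_U2.
have NhY : N%:R * Y <= 1 / 2 + Y / 2 by nra.
(* (1/2 + Y/2)^2 - Y^2 = 1/3 - (3/4)(Y - 1/3)^2, so 1/3 is the exact maximum of this bound. *)
have NY : Y ^+ 2 * (N%:R ^+ 2 - 1) <= 1 / 3.
  have : (N%:R * Y) ^+ 2 <= (1 / 2 + Y / 2) ^+ 2.
    by rewrite ler_sqr ?nnegrE ?mulr_ge0// ?ltW//; lra.
  have := sqr_ge0 (Y - 1 / 3); nra.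
apply: le_trans (@discrete_gallagher R _ (square_window eps X) prime_weight
  (fun n => (n ^ 2)%N) N ((Num.truncn X).+1 + N) Y N0 (ltW Y0) Y2 NY _) _.
  move=> n; rewrite mem_filter leq_add2r => /andP[/andP[_ /andP[_ nX]] _].
  by apply: leqW; rewrite truncn_ge_nat ?natrX//; lra.
apply: le_trans (ler_wpM2l _ (@sum_sqr_window_sum_le _ eps X N h e0 e4 X8 lX h1 hX _)) _.
- by rewrite divr_ge0// sqr_ge0.
- by rewrite ler_norml; lra.
have J0 : 0 <= Jstar eps X h by apply: Rintegral_ge0 => x _; exact: sqr_ge0.
set J := Jstar _ _ _ in J0 *; set l2 := ln X ^+ 2.
have l20 : 0 <= l2 by exact: sqr_ge0.
(* N > h - 1/2 gives N Y > 1/2 - Y/2 >= 1/4. *)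
have N16 : 81 / N%:R ^+ 2 <= 1296 * Y ^+ 2.
  have NY4 : 1 / 4 <= N%:R * Y by nra.
  rewrite ler_pdivrMr; last by rewrite exprn_gt0// ltr0n.
  nra.
apply: le_trans (ler_wpM2r _ N16) _.
  have : 0 <= h ^+ 2 / (eps * X) by rewrite divr_ge0 ?sqr_ge0//; nra.
  have := mulr_ge0 (ltW (lt_le_trans ltr01 h1)) l20; nra.
pose D := l2 / (Y * X); have D0 : 0 <= D by rewrite divr_ge0//; nra.
have D1 : D * (Y * X) = l2 by rewrite divfK//; nra.
(* The windows at the ends of [eps X, X] contribute Y log^2 X, which one of the two
   elementary terms absorbs, according to whether Y sqrt X <= 1. *)
have Yl : Y * l2 <= 16 * (Y ^+ 2 * X) + D.
  have := @sqr_ln_le R X; set s := Num.sqrt X => /(_ ltac:(lra)); rewrite -/l2 => ls.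
  have s0 : 0 <= s by exact: sqrtr_ge0.
  have s2 : s ^+ 2 = X by rewrite sqr_sqrtr; lra.
  case: (leP (Y * s) 1) => Ys.
    have : Y * l2 <= D.
      have -> : Y * l2 = D * (Y * s) ^+ 2 by rewrite -D1 exprMn s2; ring.
      by rewrite ler_piMr// expr_le1//; nra.
    nra.
  have : Y * l2 <= Y * (16 * s) by rewrite ler_pM2l.
  rewrite -s2; nra.
suff : Y ^+ 2 * (12 * h * l2 * (h ^+ 2 / (eps * X) + 1) + 4 * X + 4 * J) <=
    (2 / eps + 100) * (D + Y ^+ 2 * X + Y ^+ 2 * J).
  by move=> H; rewrite -[leLHS]mulrA -[leRHS]mulrA; apply: ler_wpM2l H; lra.
have -> : Y ^+ 2 * (12 * h * l2 * (h ^+ 2 / (eps * X) + 1) + 4 * X + 4 * J) =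
   12 * Y ^+ 2 * h ^+ 3 * l2 / (eps * X) + 12 * (h * Y) * (Y * l2) +
   4 * (Y ^+ 2 * X) + 4 * (Y ^+ 2 * J).
  by field; lra.
(* Since h Y = 1/2, Y^2 h^3 = 1/(8 Y): the squared window length produces the first term of the
   bound. *)
have -> : 12 * Y ^+ 2 * h ^+ 3 * l2 / (eps * X) = (3 / 2) / eps * D.
  by rewrite /D /h; field; lra.
rewrite hY -/D.
have ee : 0 < eps^-1 by rewrite invr_gt0.
have := mulr_ge0 (sqr_ge0 Y) J0; have : 0 <= Y ^+ 2 * X by nra.
set U := Y ^+ 2 * X in Yl *; set V := Y ^+ 2 * J => U0 V0.
have := mulr_ge0 (ltW ee) U0; have := mulr_ge0 (ltW ee) V0; have := mulr_ge0 (ltW ee) D0.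
nra.
Qed.
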